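(* Let $k$ be a positive integer and let $\sigma\in\mathrm{SIM}(X)$ be an element whose disjoint path and cycle decomposition consists only of paths. Suppose $\sigma=\alpha_1\cdots\alpha_n$, where the $\alpha_i$ are products of pairwise disjoint groups of the paths of $\sigma$ (every path of $\sigma$ lying in exactly one $\alpha_i$), each $\alpha_i$ is composed of paths of weakly varying lengths, and whenever $\sigma_s$ is a path of $\alpha_i$ and $\sigma_t$ is a path of $\alpha_j$ with $i\neq j$, we have $|\ell(\sigma_s)-\ell(\sigma_t)|>1$. Let $B_i$ be the set of digits of the paths of $\alpha_i$, and regard $\alpha_i\in\mathrm{SIM}(B_i)$. Then \[ r_k(\sigma)=r_k(\alpha_1)\cdots r_k(\alpha_n), \] where $r_k(\sigma)$ is computed in $\mathrm{SIM}(X)$ and $r_k(\alpha_i)$ in $\mathrm{SIM}(B_i)$.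
   Context: For a finite set $X$, $\mathrm{SIM}(X)$ is the symmetric inverse monoid: the set of all partial one-to-one maps from $X$ to itself, under composition. For distinct $a_1,\dots,a_\ell$, the path $[a_1a_2\cdots a_\ell]$ is the partial map sending $a_i\mapsto a_{i+1}$ for $i<\ell$ and undefined at $a_\ell$ (so $[a]$ is the nowhere-defined map on $\{a\}$); the cycle $(a_1\cdots a_\ell)$ sends $a_i\mapsto a_{i+1}$ for $i<\ell$ and $a_\ell\mapsto a_1$. Its length is $\ell$ and $a_1,\dots,a_\ell$ are its digits. Paths/cycles are disjoint if their digit sets are disjoint, and a product of disjoint paths/cycles is the partial map on the union of their digits agreeing with each one on its digits. Every element of $\mathrm{SIM}(X)$ is uniquely a product of disjoint paths and cycles whose digit sets partition $X$ (its disjoint path and cycle decomposition, length-one paths and cycles included). For a positive integer $k$, a $k$th root of $\sigma\in\mathrm{SIM}(X)$ is an $\alpha\in\mathrm{SIM}(X)$ with $\alpha^k=\sigma$, and $r_k(\sigma)$ denotes the number of $k$th roots of $\sigma$. Paths $\tau_1,\dots,\tau_r$ are of weakly varying length if they can be reordered as $\beta_1,\dots,\beta_r$ with $\ell(\beta_1)\leq\cdots\leq\ell(\beta_r)$ and $\ell(\beta_{i+1})-\ell(\beta_i)\leq 1$ for each $i$. *)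

(* Defs.v *)
From HB Require Import structures.
From mathcomp Require Import all_boot ssralg ssrint.

Set Implicit Arguments.
Unset Strict Implicit.
Unset Printing Implicit Defensive.

(* The value None means "undefined". *)
Definition partial_injective (X : finType) (f : {ffun X -> option X}) : bool :=
  [forall x, forall y, isSome (f x) ==> (f x == f y) ==> (x == y)].

Lemma partial_injectiveP (X : finType) (f : {ffun X -> option X}) :
  reflect (forall x y z, f x = Some z -> f y = Some z -> x = y)
          (partial_injective f).
Proof.
apply: (iffP idP) => [/forallP fI x y z fx fy | fI].
  by move/forallP: (fI x) => /(_ y); rewrite fx fy /= eqxx => /eqP.
apply/forallP => x; apply/forallP => y.
case fx: (f x) => [z|] //=; apply/implyP => /eqP fy.
by apply/eqP; apply: (fI x y z).
Qed.

Record SIM (X : finType) := MkSIM {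
  sim_fun :> {ffun X -> option X};
  sim_funP : partial_injective sim_fun
}.

HB.instance Definition _ (X : finType) := [isSub for @sim_fun X].
HB.instance Definition _ (X : finType) := [Finite of SIM X by <:].

Section SIMMonoid.
Variable X : finType.
Implicit Types f g h : SIM X.

Lemma sim_one_subproof : partial_injective [ffun x : X => Some x].
Proof. by apply/partial_injectiveP => x y z; rewrite !ffunE => -[->] [->]. Qed.

Definition sim_one : SIM X := MkSIM sim_one_subproof.

Lemma sim_mul_subproof f g : partial_injective [ffun x => obind g (f x)].
Proof.
apply/partial_injectiveP => x y z; rewrite !ffunE.
case fx: (f x) => [u|] //=; case fy: (f y) => [v|] //= gu gv.
have uv := partial_injectiveP _ (sim_funP g) _ _ _ gu gv.
by apply: (partial_injectiveP _ (sim_funP f) _ _ u) => //; rewrite uv.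
Qed.

(* Maps compose from left to right, as for permutations; powers do not
   depend on this choice. *)
Definition sim_mul f g : SIM X := MkSIM (sim_mul_subproof f g).

Lemma sim_mulA : associative sim_mul.
Proof.
move=> f g h; apply/val_inj/ffunP => x /=; rewrite !ffunE.
by case: (f x) => [y|] //=; rewrite ffunE.
Qed.

Lemma sim_mul1 : left_id sim_one sim_mul.
Proof. by move=> f; apply/val_inj/ffunP => x /=; rewrite !ffunE. Qed.

Lemma sim_mulr1 : right_id sim_one sim_mul.
Proof.
move=> f; apply/val_inj/ffunP => x /=; rewrite !ffunE.
by case: (f x) => [y|] //=; rewrite ffunE.
Qed.

HB.instance Definition _ :=
  isMonoid.Build (SIM X) sim_mulA sim_mul1 sim_mulr1.
End SIMMonoid.

Definition kroots (X : finType) (k : nat) (s : SIM X) : {set SIM X} :=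
  [set a : SIM X | (a ^+ k)%g == s].

Definition num_roots (X : finType) (k : nat) (s : SIM X) : nat :=
  #|kroots k s|.

(* A path [a_1 ... a_l] or a cycle (a_1 ... a_l) is represented by its
   sequence of digits [:: a_1; ...; a_l]; its length is the size. *)
Section PathsAndCycles.
Variable X : finType.
Implicit Types (p c : seq X) (ps cs : seq (seq X)).

(* Undefined at the last digit, where the index runs out of the sequence. *)
Definition path_map p (x : X) : option X := onth p (index x p).+1.

Definition cycle_map c (x : X) : option X :=
  if x \in c then Some (next c x) else None.

Definition digits ps : {set X} := [set x in flatten ps].

(* The product of disjoint paths ps and cycles cs: each digit is mapped by the
   path or cycle it belongs to. *)
Definition pc_product ps cs (x : X) : option X :=
  if ohead [seq p <- ps | x \in p] is Some p then path_map p x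
  else if ohead [seq c <- cs | x \in c] is Some c then cycle_map c x
  else None.

(* The digits of each path or cycle are distinct, and distinct paths and cycles
   are disjoint, by uniqueness of the concatenation. *)
Definition is_pc_decomposition (s : SIM X) ps cs : Prop :=
  [/\ [::] \notin ps ++ cs,
      uniq (flatten (ps ++ cs)),
      digits (ps ++ cs) = [set: X]
    & forall x, s x = pc_product ps cs x].

Definition weakly_varying ps : Prop :=
  exists bs : seq (seq X),
    [/\ perm_eq bs ps,
        sorted (fun p q => size p <= size q) bs
      & sorted (fun p q => size q - size p <= 1) bs].
End PathsAndCycles.

(* Main.v *)
Require Import Defs.
From mathcomp Require Import all_boot ssralg ssrint zify.

Set Implicit Arguments.
Unset Strict Implicit.
Unset Printing Implicit Defensive.

(* If a is a k-th root of sigma and a sends x to y, let u and v be the numbers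
   of times a can be iterated forwards and backwards from x; for y they are
   u - 1 and v + 1.  The sigma-paths of x and y have lengths
   u %/ k + v %/ k + 1 and (u - 1) %/ k + (v + 1) %/ k + 1, which differ by at
   most 1.  Hence every root of sigma preserves each group of paths, and the
   roots of sigma are exactly the unions of roots of the alpha i. *)

(** * Pointwise form of products and powers in [SIM X] *)

Section Iterates.
Variable X : finType.
Implicit Types a s : SIM X.

Lemma sim_mulE a s x : (a * s)%g x = obind s (a x).
Proof. by rewrite /= ffunE. Qed.

Lemma sim_expSr a n x : (a ^+ n.+1)%g x = obind a ((a ^+ n)%g x).
Proof. by rewrite expgSr sim_mulE. Qed.

Lemma sim_exp0 a x : (a ^+ 0)%g x = Some x.
Proof. by rewrite expg0 /= ffunE. Qed.

Lemma sim_inj a x y z : a x = Some z -> a y = Some z -> x = y.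
Proof. exact: (partial_injectiveP _ (sim_funP a)). Qed.

End Iterates.

(** * One step of a root compared with its power *)

Section RootStep.
Variables (X : finType) (a : SIM X) (k : nat) (x y : X).
Hypothesis axy : a x = Some y.
Let s := (a ^+ k.+1)%g.

Let asC n : (a * s ^+ n)%g = (s ^+ n * a)%g.
Proof. exact/commuteX/commuteX. Qed.

Let asnC n m : (a ^+ m * s ^+ n)%g = (s ^+ n * a ^+ m)%g.
Proof. exact/commuteX2/commuteX. Qed.

(** Since [a] commutes with [s], the image of [z] under [a] exists and serves as [z']. *)
Lemma root_step_reach n z :
  (s ^+ n)%g z = Some x -> exists z', (s ^+ n)%g z' = Some y.
Proof.
move=> sz; have := sim_mulE (s ^+ n)%g a z; rewrite -asC sim_mulE sz /= axy.
by case: (a z) => //= z'; exists z'.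
Qed.

(** Once [s ^+ n.+1] is written [a ^+ k * s ^+ n * a], the last step into [y] is made by [a], and
    injectivity forces it to start at [x]. *)
Lemma root_step_reachS n z :
  (s ^+ n.+1)%g z = Some y -> exists w, (s ^+ n)%g w = Some x.
Proof.
rewrite expgS {1}/s expgSr -mulgA asC mulgA !sim_mulE.
case: ((a ^+ k)%g z) => //= w; case sw: ((s ^+ n)%g w) => [u|] //= au.
by exists w; rewrite sw (sim_inj au axy).
Qed.

Lemma root_step_defined n : (s ^+ n)%g y -> (s ^+ n)%g x.
Proof.
by have := sim_mulE a (s ^+ n)%g x; rewrite asC sim_mulE axy /= => <-;
  case: ((s ^+ n)%g x).
Qed.

(** Here [s ^+ n.+1] is factored as [a * s ^+ n * a ^+ k]: from [x] it first moves to [y] and then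
    applies [s ^+ n]. *)
Lemma root_step_definedS n : (s ^+ n.+1)%g x -> (s ^+ n)%g y.
Proof.
rewrite expgS {1}/s expgS -mulgA asnC !sim_mulE axy /= sim_mulE.
by case: ((s ^+ n)%g y).
Qed.

End RootStep.

(** * Iterates along disjoint paths *)

Section PathProduct.
Variable X : finType.
Implicit Types (p q : seq X) (ps : seq (seq X)).

Lemma uniq_flatten_inj ps p q x : uniq (flatten ps) ->
  p \in ps -> q \in ps -> x \in p -> x \in q -> p = q.
Proof.
elim: ps => [//|r ps IHps] /=; rewrite cat_uniq => /and3P[_ /hasPn rps ups].
have contra t : t \in ps -> x \in t -> x \in r -> False.
  move=> tps xt xr; suff /rps : x \in flatten ps by rewrite /= xr.
  by apply/flattenP; exists t.
rewrite !inE => /predU1P[->|pps] /predU1P[->|qps] xp xq //.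
- by case: (contra q).
- by case: (contra p).
- exact: IHps.
Qed.

Lemma uniq_in_flatten ps p : uniq (flatten ps) -> p \in ps -> uniq p.
Proof.
elim: ps => [//|r ps IHps] /=; rewrite cat_uniq inE => /and3P[ur _ ups].
by case/predU1P=> [->|]; last exact: IHps.
Qed.

(** Uniqueness of [p] is a hypothesis so that the lemma serves both the full list of paths and a
    single group. *)
Lemma pc_product_path ps p x :
    (forall q, q \in ps -> x \in q -> p = q) ->
  p \in ps -> x \in p -> pc_product ps [::] x = Defs.path_map p x.
Proof.
move=> eq_p pps xp; rewrite /pc_product.
have : p \in [seq q <- ps | x \in q] by rewrite mem_filter xp.
have : all (mem ps) [seq q <- ps | x \in q].
  by apply/allP=> q; rewrite mem_filter => /andP[].
have := filter_all (fun q => x \in q) ps.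
case: [seq q <- ps | x \in q] => [//|q qs] /= /andP[xq _] /andP[qps _] _.
by rewrite (eq_p q).
Qed.

Variables (s : SIM X) (ps : seq (seq X)).
Hypothesis s_paths : is_pc_decomposition s ps [::].

Let ups : uniq (flatten ps).
Proof. by case: s_paths; rewrite cats0. Qed.

Lemma digit_path x : exists2 p, p \in ps & x \in p.
Proof.
case: s_paths => _ _; rewrite cats0 => /setP/(_ x) + _.
by rewrite !inE => /flattenP.
Qed.

Lemma decomposition_path p x : p \in ps -> x \in p -> s x = Defs.path_map p x.
Proof.
move=> pps xp; case: s_paths => _ _ _ ->; apply: pc_product_path => // q qps.
exact: (uniq_flatten_inj ups pps qps).
Qed.

Lemma path_iter p x n : p \in ps -> x \in p ->
  (s ^+ n)%g x = onth p (index x p + n).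
Proof.
move=> pps xp; elim: n => [|n IHn].
  rewrite sim_exp0 addn0 onthE (nth_map x) ?index_mem //.
  by rewrite nth_index.
rewrite sim_expSr IHn addnS.
case: (leqP (size p) (index x p + n)) => [le_p|lt_p].
  (* Past the last digit [onth] is [None], and remains so. *)
  by rewrite !onth_default // leqW.
rewrite [onth p (_ + n)]onthE (nth_map x) //=.
rewrite (decomposition_path pps) ?mem_nth //.
by rewrite /Defs.path_map index_uniq // (uniq_in_flatten ups).
Qed.

Lemma path_iter_defined p x n : p \in ps -> x \in p ->
  (s ^+ n)%g x = (index x p + n < size p) :> bool.
Proof. by move=> pps xp; rewrite (path_iter _ pps xp) onthTE. Qed.

(** Every iterated preimage of [x] lies on the path of [x], so the index counts the backward
    steps. *)
Lemma path_iter_reach p x n : p \in ps -> x \in p ->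
  (exists z, (s ^+ n)%g z = Some x) <-> n <= index x p.
Proof.
move=> pps xp; split=> [[z]|le_n]; last first.
  have lt_p : index x p - n < size p.
    by rewrite (leq_ltn_trans (leq_subr _ _)) ?index_mem.
  exists (nth x p (index x p - n)); rewrite (path_iter _ pps) ?mem_nth //.
  rewrite index_uniq ?(uniq_in_flatten ups) // subnK // onthE.
  by rewrite (nth_map x) ?index_mem // nth_index.
have [q qps zq] := digit_path z; rewrite (path_iter _ qps zq) => sz.
have xq : x \in q by apply/onthP; exists (index z q + n).
rewrite -(uniq_flatten_inj ups qps pps xq xp).
have := onthTE q (index z q + n); rewrite sz /= => /esym lt_q.
by rewrite -(onth_nth x _ _ _ sz) index_uniq ?leq_addl ?(uniq_in_flatten ups).
Qed.

(** From [x] to [y] the index stays or grows by one, and the number of digits from the point to the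
    end of its path stays or drops by one; the length is their sum. *)
Lemma root_step_size k a x y p q : 0 < k -> (a ^+ k)%g = s -> a x = Some y ->
  p \in ps -> x \in p -> q \in ps -> y \in q ->
  (size p <= (size q).+1) && (size q <= (size p).+1).
Proof.
case: k => // k _ ak axy pps xp qps yq.
have lt_i : index x p < size p by rewrite index_mem.
have lt_j : index y q < size q by rewrite index_mem.
have le_ij : index x p <= index y q.
  apply/(path_iter_reach _ qps yq).
  have [z] := (path_iter_reach (index x p) pps xp).2 (leqnn _).
  by rewrite -ak => /(root_step_reach axy).
have le_ji : index y q <= (index x p).+1.
  case def_j: (index y q) => [//|j]; rewrite ltnS.
  apply/(path_iter_reach _ pps xp).
  have [z] := (path_iter_reach j.+1 qps yq).2 (eq_leq (esym def_j)).
  by rewrite -ak => /(root_step_reachS axy).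
have le_qp : size q - index y q <= size p - index x p.
  (* The exponent is the largest one for which the iterate at [y] is defined. *)
  have := @root_step_defined _ a k x y axy (size q - index y q).-1.
  by rewrite ak !(path_iter_defined _ pps xp, path_iter_defined _ qps yq); lia.
have le_pq : size p - index x p <= (size q - index y q).+1.
  (* The successor of this exponent is the largest one defined at [x]; if [x] ends its path, the
     bound is trivial. *)
  have := @root_step_definedS _ a k x y axy (size p - index x p).-2.
  by rewrite ak !(path_iter_defined _ pps xp, path_iter_defined _ qps yq); lia.
lia.
Qed.

End PathProduct.

(** * Restricting to and gluing over a partition of [X] *)

Section Blocks.
Variables (X I : finType) (D : I -> {set X}) (block : X -> I).
Hypothesis in_D : forall i x, (x \in D i) = (block x == i).
Implicit Types a : SIM X.
Local Notation B i := {x : X | x \in D i}.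

(** Equality of options also forces [a] to map [D i] into itself. *)
Definition restricts_to (a : SIM X) i (b : SIM (B i)) :=
  forall z, omap val (b z) = a (val z).

Lemma restricts_to_exp a i (b : SIM (B i)) n :
  restricts_to a b -> restricts_to (a ^+ n)%g (b ^+ n)%g.
Proof.
move=> ab; elim: n => [|n IHn] z; first by rewrite !sim_exp0.
rewrite !sim_expSr -IHn; case: ((b ^+ n)%g z) => //= w; exact: ab.
Qed.

Lemma restricts_to_inj a i (b b' : SIM (B i)) :
  restricts_to a b -> restricts_to a b' -> b = b'.
Proof.
move=> ab ab'; apply/val_inj/ffunP=> z; apply: (inj_omap val_inj).
by rewrite ab ab'.
Qed.

Lemma restrictions_inj a a' (b : forall i, SIM (B i)) :
  (forall i, restricts_to a (b i)) -> (forall i, restricts_to a' (b i)) ->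
  a = a'.
Proof.
move=> ab ab'; apply/val_inj/ffunP=> x.
have xD : x \in D (block x) by rewrite in_D.
by rewrite -[x]/(val (exist (fun y => y \in D (block x)) x xD)) -ab -ab'.
Qed.

Lemma restr_subproof a i :
  partial_injective [ffun z : B i => obind insub (a (val z))].
Proof.
apply/partial_injectiveP=> z w v; rewrite !ffunE.
case az: (a (val z)) => [u|] //=; case: insubP => //= u' _ def_u [<-].
case aw: (a (val w)) => [t|] //=; case: insubP => //= t' _ def_t [] et.
by apply: val_inj; apply: (sim_inj az); rewrite aw -def_u -def_t et.
Qed.

(** Through [insub], images that leave [D i] become undefined, so any [a] is allowed. *)
Definition restr a i : SIM (B i) := MkSIM (restr_subproof a i).

Lemma restr_restricts a i :
  (forall x y, a x = Some y -> block y = block x) -> restricts_to a (restr a i).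
Proof.
move=> a_block z; rewrite /restr /= ffunE.
case az: (a (val z)) => [u|] //=; case: insubP => [v _ /= -> //|].
by rewrite in_D (a_block _ _ az) -in_D (valP z).
Qed.

Definition to_block x : B (block x) :=
  exist _ x (introT idP (etrans (in_D _ _) (eqxx _))).

Lemma glue_subproof (b : forall i, SIM (B i)) :
  partial_injective
    [ffun x => omap val (b (block x) (to_block x))].
Proof.
apply/partial_injectiveP=> x y z; rewrite !ffunE.
case bx: (b _ (to_block x)) => [u|] //= [uz].
case by_: (b _ (to_block y)) => [v|] //= [vz].
have xy : block x = block y.
  have := valP u; have := valP v; rewrite /= uz vz !in_D => /eqP <-.
  by move/eqP->.
(* The two values have types indexed by different blocks; generalizing the indices lets their
   equality be eliminated. *)
have eq_val i j (e : i = j) (t : B i) (t' : B j) r r' : b i t = Some r ->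
    b j t' = Some r' -> val r = val r' -> val t = val t'.
  case: j / e t' r' => t' r' bt bt' /val_inj rr'; congr (val _).
  by apply: (sim_inj bt); rewrite bt' rr'.
by apply: (eq_val _ _ xy _ _ _ _ bx by_); rewrite /= uz vz.
Qed.

Definition glue b : SIM X := MkSIM (glue_subproof b).

Lemma glue_restricts b i : restricts_to (glue b) (b i).
Proof.
case=> x xD; have e : block x = i by apply/eqP; rewrite -in_D.
case: i / e xD => xD; rewrite /glue /= ffunE.
by congr (omap val (b _ _)); apply: val_inj.
Qed.

(** Restriction is a bijection from the roots of [s] onto families of roots of the [alpha i], with
    inverse [glue]. *)
Lemma num_roots_blocks k (s : SIM X) (alpha : forall i, SIM (B i)) :
    (forall i, restricts_to s (alpha i)) ->
    (forall a x y, (a ^+ k)%g = s -> a x = Some y -> block y = block x) ->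
  num_roots k s = \prod_i num_roots k (alpha i).
Proof.
move=> s_alpha root_block.
pose F a : {dffun forall i, SIM (B i)} := [ffun i => restr a i].
rewrite /num_roots -(cardsXn (fun i => kroots k (alpha i))).
have F_restricts a i : a \in kroots k s -> restricts_to a (F a i).
  rewrite inE ffunE => /eqP ak; apply: restr_restricts => x y.
  exact: root_block ak.
rewrite -(card_in_imset (f := F)) => [|a a' Ka Ka' eqF]; last first.
  apply: (@restrictions_inj _ _ (F a)) => i; first exact: F_restricts.
  by rewrite eqF; apply: F_restricts.
apply: eq_card => b; apply/imsetP/setXnP => [[a Ka ->] i | Kb].
  rewrite inE; apply/eqP/(@restricts_to_inj s) => //.
  move: (Ka); rewrite inE => /eqP <-.
  exact/restricts_to_exp/F_restricts.
(* The power of [glue b] and [s] have the same restrictions [alpha i]. *)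
have Kg : glue b \in kroots k s.
  rewrite inE; apply/eqP/(@restrictions_inj _ _ alpha) => // i.
  have := Kb i; rewrite inE => /eqP <-.
  exact/restricts_to_exp/glue_restricts.
exists (glue b) => //; apply/ffunP => i.
apply: (@restricts_to_inj (glue b)); first exact: glue_restricts.
exact: F_restricts.
Qed.

End Blocks.

(** * The groups of paths as blocks *)

Theorem theorem5 (X : finType) (k : nat) (k_gt0 : 0 < k) (sigma : SIM X)
    (* the paths of sigma; its decomposition has no cycle *)
    (ps : seq (seq X)) (sigma_paths : is_pc_decomposition sigma ps [::])
    (* the grouping of the paths of sigma into n groups *)
    (n : nat) (P : 'I_n -> seq (seq X))
    (P_groups : perm_eq (flatten [seq P i | i <- enum 'I_n]) ps)
    (* alpha i is the product of the i-th group, as an element of SIM(B_i) *)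
    (alpha : forall i : 'I_n, SIM {x : X | x \in digits (P i)})
    (alphaE : forall (i : 'I_n) (b : {x : X | x \in digits (P i)}),
       omap val (alpha i b) = pc_product (P i) [::] (val b))
    (P_weak : forall i : 'I_n, weakly_varying (P i))
    (P_gap : forall (i j : 'I_n) (s t : seq X),
       i != j -> s \in P i -> t \in P j ->
       1 < `|size s - size t|%N) :
  num_roots k sigma = \prod_(i < n) num_roots k (alpha i).
Proof.
have ups : uniq (flatten ps) by case: sigma_paths; rewrite cats0.
have P_sub i p : p \in P i -> p \in ps.
  move=> pP; rewrite -(perm_mem P_groups); apply/flatten_mapP.
  by exists i; rewrite ?mem_enum.
have in_group x : exists i, x \in digits (P i).
  have [p] := digit_path sigma_paths x.
  rewrite -(perm_mem P_groups) => /flatten_mapP[i _ pP] xp.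
  by exists i; rewrite inE; apply/flattenP; exists p.
have [block block_in] := fin_all_exists in_group.
have in_path i x : x \in digits (P i) -> exists2 p, p \in P i & x \in p.
  by rewrite inE => /flattenP.
have same_group i j p q : p \in P i -> q \in P j ->
    (size p <= (size q).+1) && (size q <= (size p).+1) -> i = j.
  move=> pP qP close; apply/eqP/negPn/negP => /P_gap/(_ pP qP).
  by case/orP: (leq_total (size p) (size q)) => le;
    rewrite ?(distnEl le) ?(distnEr le); lia.
have block_eq i x : (x \in digits (P i)) = (block x == i).
  apply/idP/eqP=> [/in_path[p pP xp]|<- //].
  have [q qP xq] := in_path _ _ (block_in x).
  (* By disjointness [p] and [q] are one path; lying in two groups, it would violate the length
     gap. *)
  apply: (same_group _ _ _ _ qP pP).
  rewrite (uniq_flatten_inj ups (P_sub _ _ qP) (P_sub _ _ pP) xq xp).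
  by rewrite leqnSn.
apply: (num_roots_blocks block_eq) => [i z | a x y ak axy].
  rewrite alphaE; have [p pP zp] := in_path _ _ (valP z).
  rewrite (decomposition_path sigma_paths (P_sub _ _ pP) zp).
  apply: pc_product_path => // q qP zq.
  exact: (uniq_flatten_inj ups (P_sub _ _ pP) (P_sub _ _ qP) zp zq).
have [p pP xp] := in_path _ _ (block_in x).
have [q qP yq] := in_path _ _ (block_in y).
apply/esym/(same_group _ _ _ _ pP qP).
apply: (root_step_size sigma_paths k_gt0 ak axy _ xp _ yq).
- exact: P_sub pP.
- exact: P_sub qP.
Qed.
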